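(* Let $\varepsilon\in\{1,-1\}$, $n\ge1$ and $\eta\in\{+,-\}$. The element $b_{n,\eta,\varepsilon}$ is the unique non-zero idempotent in $\mathrm{TL}(B_n)_\varepsilon$ which satisfies $$s_0b_{n,\eta,\varepsilon}=\eta\, b_{n,\eta,\varepsilon}=b_{n,\eta,\varepsilon}s_0,\qquad U_ib_{n,\eta,\varepsilon}=0=b_{n,\eta,\varepsilon}U_i$$ for all $i=1,\dots,n-1$.
   Context: The ground field is $k=\mathbb{C}(q)$. $\mathrm{TL}(B_n)_\varepsilon$ is the unital $k$-algebra with generators $s_0,U_1,\dots,U_{n-1}$ and relations $U_i^2=-\varepsilon(q+q^{-1})U_i$; $U_iU_j=U_jU_i$ for $|i-j|\ge2$; $U_iU_{i+1}U_i=U_i$, $U_{i+1}U_iU_{i+1}=U_{i+1}$ for $1\le i\le n-2$; $s_0^2=1$; $U_1s_0U_1=0$; $s_0U_i=U_is_0$ for $2\le i\le n-1$. $\mathrm{TL}(B_n)_\varepsilon$ is regarded as a subalgebra of $\mathrm{TL}(B_{n+1})_\varepsilon$ via the generators of the same name. For $\eta\in\{+,-\}$ (identified with the sign $\pm1$), $b_{n,\eta,\varepsilon}\in\mathrm{TL}(B_n)_\varepsilon$ is defined recursively by $b_{1,\eta,\varepsilon}=\frac12(1+\eta s_0)$ and $$b_{n+1,\eta,\varepsilon}=b_{n,\eta,\varepsilon}+\varepsilon\frac{q^{n-1}+q^{-(n-1)}}{q^n+q^{-n}}\,b_{n,\eta,\varepsilon}U_nb_{n,\eta,\varepsilon}.$$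 *)

(* Defs.v *)
From HB Require Import structures.
From mathcomp Require Import all_boot all_order all_algebra.
From mathcomp Require Import generic_quotient ring_quotient fraction.
From mathcomp Require Import boolp reals complex.
From mathcomp Require Import monalg.

Set Implicit Arguments.
Unset Strict Implicit.
Unset Printing Implicit Defensive.

Import GRing.Theory.

Local Open Scope ring_scope.
Local Open Scope quotient_scope.

Section Ideal.
Variables (R : nzRingType) (S : R -> Prop).

(* The two-sided ideal generated by S. *)
Inductive ideal_gen : R -> Prop :=
| ideal_gen_in x of S x : ideal_gen x
| ideal_gen0 : ideal_gen 0
| ideal_genD x y of ideal_gen x & ideal_gen y : ideal_gen (x + y)
| ideal_genMl a x of ideal_gen x : ideal_gen (a * x)
| ideal_genMr a x of ideal_gen x : ideal_gen (x * a).

Definition idealb : {pred R} := fun x => `[< ideal_gen x >].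

Lemma idealbP x : reflect (ideal_gen x) (x \in idealb).
Proof. exact: asboolP. Qed.

Lemma idealb_zmod_closed : zmod_closed idealb.
Proof.
split=> [|x y /idealbP Ix /idealbP Iy]; apply/idealbP; first exact: ideal_gen0.
by rewrite -mulN1r; apply/ideal_genD/ideal_genMl.
Qed.

HB.instance Definition _ := GRing.isZmodClosed.Build R idealb idealb_zmod_closed.

(* The library quotients an additive group by a subgroup, and a commutative
   ring by an ideal; the ring structure is added here for any two-sided ideal,
   which is not required to be proper. *)
Definition ring_quot : Type := Quotient.quot idealb.

HB.instance Definition _ := GRing.Zmodule.on ring_quot.

Fact pi_quot_key : unit. Proof. by []. Qed.
Definition pi_quot (x : R) : ring_quot :=
  locked_with pi_quot_key (fun y => \pi_(Quotient.quot idealb) y) x.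

Lemma pi_quotE x : pi_quot x = \pi_(Quotient.quot idealb) x.
Proof. by rewrite /pi_quot unlock. Qed.

Lemma pi_quotP x y : pi_quot x = pi_quot y <-> ideal_gen (x - y).
Proof.
rewrite !pi_quotE; split => [/eqP|Ixy].
  by rewrite -Quotient.idealrBE => /idealbP.
by apply/eqP; rewrite -Quotient.idealrBE; apply/idealbP.
Qed.

Definition quot_repr (x : ring_quot) : R := repr (x : Quotient.quot idealb).

Lemma quot_reprK : cancel quot_repr pi_quot.
Proof. by move=> x; rewrite pi_quotE /quot_repr reprK. Qed.

Lemma pi_quot_zmod : zmod_morphism pi_quot.
Proof. by move=> x y; rewrite !pi_quotE raddfB. Qed.

HB.instance Definition _ := GRing.isZmodMorphism.Build R ring_quot pi_quot
  pi_quot_zmod.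

Lemma quot_repr_pi x : ideal_gen (quot_repr (pi_quot x) - x).
Proof. by apply/pi_quotP; rewrite quot_reprK. Qed.

Definition quot_one : ring_quot := pi_quot 1.
Definition quot_mul : ring_quot -> ring_quot -> ring_quot :=
  locked_with pi_quot_key (fun x y => pi_quot (quot_repr x * quot_repr y)).

Lemma pi_quotM_subproof x y :
  quot_mul (pi_quot x) (pi_quot y) = pi_quot (x * y).
Proof.
rewrite /quot_mul unlock; apply/pi_quotP.
set x' := quot_repr _; set y' := quot_repr _.
have -> : x' * y' - x * y = (x' - x) * y' + x * (y' - y).
  by rewrite mulrBl mulrBr addrA subrK.
by apply: ideal_genD; [apply: ideal_genMr | apply: ideal_genMl];
   apply: quot_repr_pi.
Qed.

Lemma quot_mulA : associative quot_mul.
Proof.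
move=> x y z; rewrite -[x]quot_reprK -[y]quot_reprK -[z]quot_reprK.
by rewrite !pi_quotM_subproof mulrA.
Qed.

Lemma quot_mul1 : left_id quot_one quot_mul.
Proof. by move=> x; rewrite -[x]quot_reprK pi_quotM_subproof mul1r. Qed.

Lemma quot_mulr1 : right_id quot_one quot_mul.
Proof. by move=> x; rewrite -[x]quot_reprK pi_quotM_subproof mulr1. Qed.

Lemma quot_mulDl : left_distributive quot_mul +%R.
Proof.
move=> x y z; rewrite -[x]quot_reprK -[y]quot_reprK -[z]quot_reprK.
by rewrite -raddfD !pi_quotM_subproof mulrDl raddfD.
Qed.

Lemma quot_mulDr : right_distributive quot_mul +%R.
Proof.
move=> x y z; rewrite -[x]quot_reprK -[y]quot_reprK -[z]quot_reprK.
by rewrite -raddfD !pi_quotM_subproof mulrDr raddfD.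
Qed.

HB.instance Definition _ := GRing.Zmodule_isPzRing.Build ring_quot
  quot_mulA quot_mul1 quot_mulr1 quot_mulDl quot_mulDr.

Lemma pi_quot_monoid : monoid_morphism pi_quot.
Proof. by split=> [|x y] //; rewrite -pi_quotM_subproof. Qed.

HB.instance Definition _ := GRing.isMonoidMorphism.Build R ring_quot pi_quot
  pi_quot_monoid.

End Ideal.

Lemma scalerAr_comm (k : pzRingType) (A : lalgType k) (c : k) (x y : A) :
  c%:A * x = x * c%:A -> c *: (x * y) = x * (c *: y).
Proof. by move=> cx; rewrite -mulr_algl mulrA cx -mulrA mulr_algl. Qed.

Lemma in_algM (k : pzRingType) (A : lalgType k) (a b : k) :
  a%:A * b%:A = (a * b)%:A :> A.
Proof. by rewrite mulr_algl scalerA. Qed.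

Section FreeAlgebra.
Variables (k : fieldType) (I : choiceType).

Local Notation MA := {malg k[{fmonom I}]}.

(* The free algebra on I is the monoid algebra of the free monoid on I. Its
   operations are locked copies, so that unification never unfolds the
   convolution product. *)
Definition free_alg : Type := MA.

HB.instance Definition _ := GRing.Zmodule.on free_alg.

Fact free_alg_key : unit. Proof. by []. Qed.
Definition free_one : free_alg := locked_with free_alg_key (1 : MA).
Definition free_mul : free_alg -> free_alg -> free_alg :=
  locked_with free_alg_key (fun x y : MA => x * y).
Definition free_scale : k -> free_alg -> free_alg :=
  locked_with free_alg_key (fun (c : k) (x : MA) => c *: x).

Lemma free_oneE : free_one = (1 : MA). Proof. exact: unlock. Qed.
Lemma free_mulE x y : free_mul x y = (x : MA) * (y : MA).
Proof. by rewrite /free_mul unlock. Qed.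
Lemma free_scaleE c x : free_scale c x = c *: (x : MA).
Proof. by rewrite /free_scale unlock. Qed.

Lemma free_mulA : associative free_mul.
Proof. by move=> x y z; rewrite !free_mulE mulrA. Qed.
Lemma free_mul1 : left_id free_one free_mul.
Proof. by move=> x; rewrite free_mulE free_oneE mul1r. Qed.
Lemma free_mulr1 : right_id free_one free_mul.
Proof. by move=> x; rewrite free_mulE free_oneE mulr1. Qed.
Lemma free_mulDl : left_distributive free_mul +%R.
Proof. by move=> x y z; rewrite !free_mulE -(mulrDl (x : MA)). Qed.
Lemma free_mulDr : right_distributive free_mul +%R.
Proof. by move=> x y z; rewrite !free_mulE -(mulrDr (x : MA)). Qed.
Lemma free_oner_neq0 : free_one != 0.
Proof. by rewrite free_oneE (oner_neq0 MA). Qed.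

HB.instance Definition _ := GRing.Zmodule_isNzRing.Build free_alg
  free_mulA free_mul1 free_mulr1 free_mulDl free_mulDr free_oner_neq0.

Lemma free_scalerA a b x : free_scale a (free_scale b x) = free_scale (a * b) x.
Proof. by rewrite !free_scaleE scalerA. Qed.
Lemma free_scale1r : left_id 1 free_scale.
Proof. by move=> x; rewrite free_scaleE scale1r. Qed.
Lemma free_scalerDr : right_distributive free_scale +%R.
Proof. by move=> a x y; rewrite !free_scaleE -(scalerDr a (x : MA)). Qed.
Lemma free_scalerDl x : {morph free_scale^~ x : a b / a + b}.
Proof. by move=> a b; rewrite !free_scaleE scalerDl. Qed.

HB.instance Definition _ := GRing.Zmodule_isLmodule.Build k free_alg
  free_scalerA free_scale1r free_scalerDr free_scalerDl.

Lemma free_scalerAl (a : k) (x y : free_alg) : a *: (x * y) = (a *: x) * y.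
Proof.
rewrite -[LHS]/(free_scale a (free_mul x y)) -[RHS]/(free_mul (free_scale a x) y).
by rewrite !free_scaleE !free_mulE scalerAl.
Qed.

HB.instance Definition _ := GRing.Lmodule_isLalgebra.Build k free_alg
  free_scalerAl.

Fact fvar_key : unit. Proof. by []. Qed.
Definition fvar (i : I) : free_alg :=
  locked_with fvar_key (fun j => << fmu j >>) i.

Lemma fvarE i : fvar i = << fmu i >>.
Proof. by rewrite /fvar unlock. Qed.

Lemma free_alg1E : (1 : free_alg) = (1 : MA). Proof. exact: free_oneE. Qed.
Lemma free_algME (x y : free_alg) : x * y = (x : MA) * (y : MA).
Proof. exact: free_mulE. Qed.
Lemma free_algZE c (x : free_alg) : c *: x = c *: (x : MA).
Proof. exact: free_scaleE. Qed.

Lemma free_alg_ind (P : free_alg -> Prop) :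
  P 1 -> (forall a x y, P x -> P y -> P (a *: x + y)) ->
  (forall i x, P x -> P (fvar i * x)) -> forall x, P x.
Proof.
move=> P1 Plin Pvar x.
have P0 : P 0 by rewrite -[0](addNr (1 : free_alg)) -scaleN1r; apply: Plin.
have PD (y z : free_alg) : P y -> P z -> P (y + z).
  by move=> Py Pz; rewrite -[y]scale1r; apply: Plin.
have PZ c (y : free_alg) : P y -> P (c *: y).
  by move=> Py; rewrite -[c *: y]addr0; apply: Plin.
rewrite [x]monalgE; apply: big_ind => // m _.
have -> : << x@_m *g m >> = x@_m *: (<< m >> : free_alg).
  by rewrite free_algZE; apply/malgP => m'; rewrite mcoeffZ !mcoeffU mulr_natr.
apply: PZ; rewrite -[m]fmK; elim: (m : seq I) => [|i s IHs].
  by move: P1; rewrite free_alg1E -fmoneE.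
have -> : << FMonom (i :: s) >> = fvar i * (<< FMonom s >> : free_alg).
  by rewrite free_algME fvarE malgM_def fgmulUU mul1r fmuE /mmul /= fmmulE.
exact: Pvar.
Qed.

Lemma free_alg_scalerAr (c : k) (x y : free_alg) : c *: (x * y) = x * (c *: y).
Proof.
elim/free_alg_ind: x => [|a x z IHx IHz|i x IHx]; first by rewrite !mul1r.
  by rewrite !mulrDl -!scalerAl scalerDr IHz -IHx !scalerA mulrC.
rewrite -!mulrA -IHx; move: (x * y) => {IHx x}y; apply: scalerAr_comm.
rewrite free_algZE free_alg1E -mul_malgC mulr1 !free_algME fvarE.
by rewrite !malgM_def !fgmulUU mulrC mul1m mulm1.
Qed.

Variables (A : algType k) (g : I -> A).

Definition word_eval (m : {fmonom I}) : A := \prod_(i <- (m : seq I)) g i.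

Lemma word_eval_mmorphism : mmorphism word_eval.
Proof.
by split=> [m1 m2|]; rewrite /word_eval ?fmM ?big_cat ?fm1 ?big_nil.
Qed.

HB.instance Definition _ := isMultiplicative.Build _ _ word_eval
  word_eval_mmorphism.

(* The unital algebra morphism sending the free generators to the g i. *)
Definition free_eval (x : free_alg) : A := mmap (in_alg A) word_eval x.

Lemma free_eval_zmod : zmod_morphism free_eval.
Proof. exact: raddfB. Qed.

HB.instance Definition _ := GRing.isZmodMorphism.Build free_alg A free_eval
  free_eval_zmod.

Lemma free_eval_monoid : monoid_morphism free_eval.
Proof.
have commA (x : MA) m m' : GRing.comm (in_alg A x@_m) (word_eval m').
  by rewrite /GRing.comm /= mulr_algl mulr_algr.
have [M1 M2] := commr_mmap_is_multiplicative commA; split=> [|x y].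
  by rewrite free_alg1E.
by rewrite free_algME.
Qed.

HB.instance Definition _ := GRing.isMonoidMorphism.Build free_alg A free_eval
  free_eval_monoid.

Lemma free_eval_scalable : scalable free_eval.
Proof. by move=> c x; rewrite free_algZE /free_eval mmapZ /= mulr_algl. Qed.

HB.instance Definition _ := GRing.isScalable.Build k free_alg A *:%R free_eval
  free_eval_scalable.

Lemma free_eval_var i : free_eval (fvar i) = g i.
Proof.
by rewrite fvarE /free_eval mmapU /= scale1r mul1r /word_eval fmU big_seq1.
Qed.

End FreeAlgebra.

Arguments fvar {k I} i.

(* The generators of TL(B_n): s_0, and U_i for 0 < i < n. *)
Inductive tlb_gen (n : nat) : Type :=
| gen_s0
| gen_U (i : nat) of (0 < i < n)%N.

Arguments gen_s0 {n}.
Arguments gen_U {n} i _.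

HB.instance Definition _ n := gen_eqMixin (tlb_gen n).
HB.instance Definition _ n := gen_choiceMixin (tlb_gen n).

Section TLB.
Variables (k : fieldType) (q eps : k) (n : nat).

Local Notation F := (free_alg k (tlb_gen n)).
Local Notation s0 := (fvar gen_s0 : F).
Local Notation "'U[' h ]" := (fvar (gen_U _ h) : F) (at level 0).

(* tlb_rel x y: the relation x = y is one of the defining relations. *)
Inductive tlb_rel : F -> F -> Prop :=
| tlb_UU i (hi : (0 < i < n)%N) :
    tlb_rel (U[hi] ^+ 2) (- (eps * (q + q^-1)) *: U[hi])
| tlb_UC i j (hi : (0 < i < n)%N) (hj : (0 < j < n)%N) :
    (i.+2 <= j)%N || (j.+2 <= i)%N ->
    tlb_rel (U[hi] * U[hj]) (U[hj] * U[hi])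
| tlb_UUpU i (hi : (0 < i < n)%N) (hi1 : (0 < i.+1 < n)%N) :
    tlb_rel (U[hi] * U[hi1] * U[hi]) U[hi]
| tlb_UpUUp i (hi : (0 < i < n)%N) (hi1 : (0 < i.+1 < n)%N) :
    tlb_rel (U[hi1] * U[hi] * U[hi1]) U[hi1]
| tlb_ss : tlb_rel (s0 ^+ 2) 1
| tlb_U1sU1 (h1 : (0 < 1 < n)%N) : tlb_rel (U[h1] * s0 * U[h1]) 0
| tlb_sU i (hi : (0 < i < n)%N) : (2 <= i)%N ->
    tlb_rel (s0 * U[hi]) (U[hi] * s0).

Definition tlb_relator (z : F) : Prop :=
  exists x y, tlb_rel x y /\ z = x - y.

Definition TLB : Type := ring_quot tlb_relator.

HB.instance Definition _ := GRing.PzRing.on TLB.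

Definition tlb_pi (x : F) : TLB := pi_quot tlb_relator x.

HB.instance Definition _ := GRing.isZmodMorphism.Build F TLB tlb_pi
  (@pi_quot_zmod _ tlb_relator).
HB.instance Definition _ := GRing.isMonoidMorphism.Build F TLB tlb_pi
  (@pi_quot_monoid _ tlb_relator).

Lemma tlb_piP x : exists y, x = tlb_pi y.
Proof. by exists (quot_repr x); rewrite /tlb_pi quot_reprK. Qed.

Lemma tlb_pi_rel x y : tlb_rel x y -> tlb_pi x = tlb_pi y.
Proof. by move=> rxy; apply/pi_quotP/ideal_gen_in; exists x, y. Qed.

Lemma tlb_ideal_ker (A : algType k) (f : tlb_gen n -> A) :
  (forall x y, tlb_rel x y -> free_eval f x = free_eval f y) ->
  forall x y, tlb_pi x = tlb_pi y -> free_eval f x = free_eval f y.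
Proof.
move=> frel x y /pi_quotP Ixy; apply/eqP; rewrite -subr_eq0 -raddfB /=; apply/eqP.
elim: Ixy => [_ [u [v [ruv ->]]]||u v _ IHu _ IHv|u v _ IHv|u v _ IHv].
- by rewrite raddfB /= (frel _ _ ruv) subrr.
- by rewrite raddf0.
- by rewrite raddfD /= IHu IHv addr0.
- by rewrite rmorphM /= IHv mulr0.
- by rewrite rmorphM /= IHv mul0r.
Qed.

Lemma tlb_rel_eval (A : algType k) (f : tlb_gen n -> A) :
  let s := f gen_s0 in
  let U i (hi : (0 < i < n)%N) := f (gen_U i hi) in
  (forall i hi, U i hi ^+ 2 = - (eps * (q + q^-1)) *: U i hi) ->
  (forall i j hi hj, (i.+2 <= j)%N || (j.+2 <= i)%N ->
     U i hi * U j hj = U j hj * U i hi) ->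
  (forall i hi hi1, U i hi * U i.+1 hi1 * U i hi = U i hi) ->
  (forall i hi hi1, U i.+1 hi1 * U i hi * U i.+1 hi1 = U i.+1 hi1) ->
  s ^+ 2 = 1 ->
  (forall h1, U 1%N h1 * s * U 1%N h1 = 0) ->
  (forall i hi, (2 <= i)%N -> s * U i hi = U i hi * s) ->
  forall x y, tlb_rel x y -> free_eval f x = free_eval f y.
Proof.
move=> s U fUU fUC fUUpU fUpUUp fss fU1sU1 fsU x y; case.
- by move=> i hi; rewrite rmorphXn linearZ /= free_eval_var; exact: fUU.
- by move=> i j hi hj hij; rewrite !rmorphM /= !free_eval_var; exact: fUC.
- by move=> i hi hi1; rewrite !rmorphM /= !free_eval_var; exact: fUUpU.
- by move=> i hi hi1; rewrite !rmorphM /= !free_eval_var; exact: fUpUUp.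
- by rewrite rmorphXn rmorph1 /= free_eval_var; exact: fss.
- by move=> h1; rewrite !rmorphM rmorph0 /= !free_eval_var; exact: fU1sU1.
- by move=> i hi i2; rewrite !rmorphM /= !free_eval_var; exact: fsU.
Qed.

Lemma tlb_oner_neq0 : 1 != 0 :> TLB.
Proof.
pose f (g : tlb_gen n) : k^o := if g is gen_s0 then 1 else 0.
have frel := @tlb_rel_eval _ f.
have /tlb_ideal_ker fker x y : tlb_rel x y -> free_eval f x = free_eval f y.
  apply: frel => *; rewrite /f ?mulr0 ?mul0r //.
  - by rewrite expr0n scaler0.
  - by rewrite expr1n.
apply/eqP; rewrite -[1](rmorph1 tlb_pi) -[0](rmorph0 tlb_pi).
move=> /fker; rewrite rmorph1 rmorph0 => /eqP.
by rewrite oner_eq0.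
Qed.

HB.instance Definition _ := GRing.PzSemiRing_isNonZero.Build TLB tlb_oner_neq0.

Definition tlb_scale (c : k) (x : TLB) : TLB := tlb_pi (c *: 1) * x.

Lemma tlb_piZ_subproof c x : tlb_scale c (tlb_pi x) = tlb_pi (c *: x).
Proof. by rewrite /tlb_scale -rmorphM mulr_algl. Qed.

Lemma tlb_scalerA a b x : tlb_scale a (tlb_scale b x) = tlb_scale (a * b) x.
Proof.
by rewrite /tlb_scale mulrA -rmorphM in_algM.
Qed.

Lemma tlb_scale1r : left_id 1 tlb_scale.
Proof. by move=> x; rewrite /tlb_scale scale1r rmorph1 mul1r. Qed.

Lemma tlb_scalerDr : right_distributive tlb_scale +%R.
Proof. by move=> a x y; rewrite /tlb_scale mulrDr. Qed.

Lemma tlb_scalerDl x : {morph tlb_scale^~ x : a b / a + b}.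
Proof. by move=> a b; rewrite /tlb_scale scalerDl raddfD mulrDl. Qed.

HB.instance Definition _ := GRing.Zmodule_isLmodule.Build k TLB
  tlb_scalerA tlb_scale1r tlb_scalerDr tlb_scalerDl.

Lemma tlb_scalerAl (a : k) (x y : TLB) : a *: (x * y) = (a *: x) * y.
Proof. exact: mulrA. Qed.

HB.instance Definition _ := GRing.Lmodule_isLalgebra.Build k TLB tlb_scalerAl.

Lemma tlb_scalerAr (a : k) (x y : TLB) : a *: (x * y) = x * (a *: y).
Proof.
have [x' ->] := tlb_piP x; have [y' ->] := tlb_piP y.
have piZ c z : c *: tlb_pi z = tlb_pi (c *: z) by exact: tlb_piZ_subproof.
by rewrite piZ -!rmorphM piZ free_alg_scalerAr.
Qed.

HB.instance Definition _ := GRing.Lalgebra_isAlgebra.Build k TLB tlb_scalerAr.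

Lemma tlb_pi_scalable : scalable tlb_pi.
Proof. by move=> c x; rewrite -tlb_piZ_subproof. Qed.

HB.instance Definition _ := GRing.isScalable.Build k F TLB *:%R tlb_pi
  tlb_pi_scalable.

Definition tlb_s0 : TLB := tlb_pi s0.
Definition tlb_U i (hi : (0 < i < n)%N) : TLB := tlb_pi U[hi].

End TLB.

Arguments tlb_s0 {k q eps n}.
Arguments tlb_U {k q eps n} i hi.

Section Inclusion.
Variables (k : fieldType) (q eps : k).
Local Notation TLB := (TLB q eps).

Lemma widen_bound n i : (0 < i < n)%N -> (0 < i < n.+1)%N.
Proof. by case/andP=> -> /ltnW. Qed.

Definition tlb_widen n (g : tlb_gen n) : TLB n.+1 :=
  match g with
  | gen_s0 => tlb_s0
  | gen_U i hi => tlb_U i (widen_bound hi)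
  end.

(* The canonical algebra morphism TL(B_n) -> TL(B_(n+1)), preserving the
   names of the generators. *)
Definition tlb_incl n (x : TLB n) : TLB n.+1 :=
  free_eval (@tlb_widen n) (quot_repr x).

Lemma tlb_widen_rel n (x y : free_alg k (tlb_gen n)) : tlb_rel q eps x y ->
  free_eval (@tlb_widen n) x = free_eval (@tlb_widen n) y.
Proof.
apply: tlb_rel_eval => /=.
- by move=> i hi; rewrite -rmorphXn -linearZ; apply/tlb_pi_rel/tlb_UU.
- by move=> i j hi hj hij; rewrite -!rmorphM; apply/tlb_pi_rel/tlb_UC.
- by move=> i hi hi1; rewrite -!rmorphM; apply/tlb_pi_rel/tlb_UUpU.
- by move=> i hi hi1; rewrite -!rmorphM; apply/tlb_pi_rel/tlb_UpUUp.
- rewrite -(rmorph1 (@tlb_pi k q eps n.+1)) -rmorphXn; apply/tlb_pi_rel/tlb_ss.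
- move=> h1; rewrite -(rmorph0 (@tlb_pi k q eps n.+1)) -!rmorphM.
  exact/tlb_pi_rel/tlb_U1sU1.
- by move=> i hi i2; rewrite -!rmorphM; apply/tlb_pi_rel/tlb_sU.
Qed.

Lemma tlb_incl_pi n (x : free_alg k (tlb_gen n)) :
  tlb_incl (tlb_pi q eps x) = free_eval (@tlb_widen n) x.
Proof.
by apply: (tlb_ideal_ker (@tlb_widen_rel n)); rewrite /tlb_pi quot_reprK.
Qed.

Lemma tlb_incl_zmod n : zmod_morphism (@tlb_incl n).
Proof.
move=> x y; have [x' ->] := tlb_piP x; have [y' ->] := tlb_piP y.
by rewrite -raddfB !tlb_incl_pi raddfB.
Qed.

HB.instance Definition _ n := GRing.isZmodMorphism.Build (TLB n) (TLB n.+1)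
  (@tlb_incl n) (@tlb_incl_zmod n).

Lemma tlb_incl_monoid n : monoid_morphism (@tlb_incl n).
Proof.
split=> [|x y].
  by rewrite -[X in tlb_incl X](rmorph1 (@tlb_pi k q eps n)) tlb_incl_pi rmorph1.
have [x' ->] := tlb_piP x; have [y' ->] := tlb_piP y.
by rewrite -rmorphM !tlb_incl_pi rmorphM.
Qed.

HB.instance Definition _ n := GRing.isMonoidMorphism.Build (TLB n) (TLB n.+1)
  (@tlb_incl n) (@tlb_incl_monoid n).

Lemma tlb_incl_scalable n : scalable (@tlb_incl n).
Proof.
move=> c x; have [x' ->] := tlb_piP x.
by rewrite -linearZ !tlb_incl_pi linearZ.
Qed.

HB.instance Definition _ n := GRing.isScalable.Build k (TLB n) (TLB n.+1) *:%R
  (@tlb_incl n) (@tlb_incl_scalable n).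

Lemma tlb_incl_s0 n : tlb_incl (tlb_s0 : TLB n) = tlb_s0.
Proof. by rewrite tlb_incl_pi free_eval_var. Qed.

Lemma tlb_incl_U n i (hi : (0 < i < n)%N) (hi' : (0 < i < n.+1)%N) :
  tlb_incl (tlb_U i hi : TLB n) = tlb_U i hi'.
Proof.
by rewrite tlb_incl_pi free_eval_var /= (bool_irrelevance (widen_bound hi) hi').
Qed.

End Inclusion.

Section BElement.
Variables (k : fieldType) (q eps eta : k).

(* tlb_b n is b_(n, eta, eps) for 0 < n; tlb_b 0 is a dummy value. *)
Fixpoint tlb_b (n : nat) : TLB q eps n :=
  match n with
  | 0 => 0
  | m.+1 =>
    match m return TLB q eps m -> TLB q eps m.+1 with
    | 0 => fun _ => 2^-1 *: (1 + eta *: tlb_s0)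
    | p.+1 => fun b_m =>
        let b := tlb_incl b_m in
        b + (eps * ((q ^+ p + q ^- p) / (q ^+ p.+1 + q ^- p.+1))) *:
            (b * tlb_U p.+1 (ltnSn p.+1) * b)
    end (tlb_b m)
  end.

Lemma tlb_b1 : tlb_b 1 = 2^-1 *: (1 + eta *: tlb_s0).
Proof. by []. Qed.

Lemma tlb_bS n (hn : (0 < n < n.+1)%N) : let b := tlb_incl (tlb_b n) in
  tlb_b n.+1 =
  b + (eps * ((q ^+ n.-1 + q ^- n.-1) / (q ^+ n + q ^- n))) *:
      (b * tlb_U n hn * b).
Proof.
case: n hn => // p hn.
by rewrite (bool_irrelevance hn (ltnSn p.+1 : (0 < p.+1 < p.+2)%N)).
Qed.

End BElement.

(* C(q), where C = R[i]. *)
Definition Cq (R : realType) : fieldType := {fraction {poly complex R}}.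
Definition Cq_q (R : realType) : Cq R := tofrac 'X.

(* Main.v *)
Require Import Defs.
From mathcomp Require Import all_boot all_order all_algebra.
From mathcomp Require Import boolp reals complex.
From mathcomp Require Import fraction ring.

(** The elements annihilated by all [U_i] on which [s_0] acts by [eta] are
    common eigenvectors for left and right multiplication by the whole algebra,
    with a common eigenvalue. If [e] and [f] are two such nonzero idempotents,
    the eigenvalues of both are [1], so [e = f e = f]. The recursion stays
    inside this set because [U_n b_n U_n] is
    [-eps (q^n + q^-n) / (q^(n-1) + q^-(n-1))] times [b_(n-1) U_n], with
    [b_0 = 1]. Finally [b_n] is nonzero because the one-dimensional
    representation [s_0 |-> eta], [U_i |-> 0] maps it to [1]. *)

Import GRing.Theory.
Local Open Scope ring_scope.

(* To be read with [a = b_(n-1)], [b = b_n], [u = U_n] and [v = U_(n+1)]. *)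
Section RecursionStep.
Variables (k : fieldType) (A : algType k) (a b u v : A) (c x y : k).
Hypothesis bb : b * b = b.

Let b' := b + c *: (b * u * b).

Lemma step_absorbl : b * b' = b'.
Proof. by rewrite /b' mulrDr -scalerAr !mulrA !bb. Qed.

Lemma step_absorbr : b' * b = b'.
Proof. by rewrite /b' mulrDl -scalerAl -!mulrA !bb. Qed.

Section Annihilation.
Hypotheses (ubu : u * b * u = x *: (a * u)) (au : a * u = u * a).
Hypotheses (ab : a * b = b) (ba : b * a = b) (cx : c * x = -1).

(** By [ubu] and [cx], the correction term contributes [- a * u * b]. Moving [a] past [u] and
    absorbing it into [b] turns this into [- u * b], which cancels the first term. *)
Lemma step_annl : u * b' = 0.
Proof.
rewrite /b' mulrDr -scalerAr !mulrA ubu -!scalerAl scalerA cx scaleN1r.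
by rewrite au -mulrA ab subrr.
Qed.

Lemma step_annr : b' * u = 0.
Proof.
have bubu : b * u * b * u = b * (u * b * u) by rewrite !mulrA.
by rewrite /b' mulrDl -scalerAl bubu ubu -scalerAr scalerA cx scaleN1r mulrA ba subrr.
Qed.

(** Expanding the right factor, [b' * b] is [b'], and the correction term contains [b' * u = 0]. *)
Lemma step_idem : b' * b' = b'.
Proof.
rewrite {2}/b' mulrDr step_absorbr -scalerAr !mulrA step_absorbr step_annr.
by rewrite mul0r scaler0 addr0.
Qed.

End Annihilation.

(** Reproduces the hypothesis [ubu] one level up, with [b], [v], [y + c] in place of [a], [u], [x].
    As [v] commutes with [b], the two terms reduce to [b * v ^+ 2] and [b * (v * u * v) * b]. *)
Lemma step_cup : b * v = v * b -> v * u * v = v -> v ^+ 2 = y *: v ->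
  v * b' * v = (y + c) *: (b * v).
Proof.
move=> bv vuv vv; rewrite /b' mulrDr mulrDl -scalerAr -scalerAl scalerDl.
congr (_ + _ *: _); first by rewrite -bv -mulrA -expr2 vv -scalerAr.
have -> : v * (b * u * b) * v = b * (v * u * v) * b.
  by rewrite !mulrA -bv -!mulrA bv.
by rewrite vuv -mulrA -bv mulrA bb.
Qed.

End RecursionStep.

Section Projector.
Variables (k : fieldType) (q eps eta : k).
Local Notation TLB := (TLB q eps).
Local Notation b n := (tlb_b q eps eta n).
Local Notation d n := (q ^+ n + q ^- n).

Definition tlb_eigen n (e : TLB n) :=
  [/\ tlb_s0 * e = eta *: e, e * tlb_s0 = eta *: e &
      forall i (hi : (0 < i < n)%N), tlb_U i hi * e = 0 /\ e * tlb_U i hi = 0].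

(** The scalar depends on [x] alone, hence is shared by all [e] and by both sides. It is built along
    words: a letter [s_0] multiplies it by [eta], a letter [U_i] makes it zero. *)
Lemma tlb_eigen_scalar n (x : TLB n) :
  exists c, forall e, tlb_eigen n e -> x * e = c *: e /\ e * x = c *: e.
Proof.
have [x' ->] := tlb_piP x.
elim/free_alg_ind: x' {x} => [|c x y [cx IHx] [cy IHy]|g x [cx IHx]].
- by exists 1 => e _; rewrite rmorph1 mul1r mulr1 scale1r.
- exists (c * cx + cy) => e ev; have [lx rx] := IHx e ev; have [ly ry] := IHy e ev.
  rewrite linearP mulrDl mulrDr -scalerAl -scalerAr lx rx ly ry.
  by rewrite scalerDl scalerA.
- case: g => [|i hi].
    exists (eta * cx) => e ev; have [lx rx] := IHx e ev; have [ls rs _] := ev.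
    rewrite rmorphM -/tlb_s0 -mulrA lx -scalerAr ls mulrA rs -scalerAl rx.
    by rewrite !scalerA mulrC.
  exists 0 => e ev; have [lx rx] := IHx e ev; have [_ _ /(_ i hi)[lU rU]] := ev.
  by rewrite rmorphM -/(tlb_U i hi) -mulrA lx -scalerAr lU mulrA rU mul0r scaler0 scale0r.
Qed.

Lemma tlb_eigen_idem_unique n (e f : TLB n) :
  e <> 0 -> e * e = e -> tlb_eigen n e ->
  f <> 0 -> f * f = f -> tlb_eigen n f -> e = f.
Proof.
have eig1 (g h : TLB n) : g <> 0 -> g * g = g -> tlb_eigen n g ->
    tlb_eigen n h -> g * h = h /\ h * g = h.
  (* The idempotent [g] acts on itself by [c], so [g * g = g] and [g <> 0] force [c = 1]. *)
  move=> /eqP g0 gg gev hev; have [c cP] := tlb_eigen_scalar n g.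
  have [cg _] := cP g gev; have c1 : c = 1.
    apply/eqP; rewrite -subr_eq0.
    have : (c - 1) *: g == 0 by rewrite scalerBl -cg gg scale1r subrr.
    by rewrite scaler_eq0 (negPf g0) orbF.
  by have := cP h hev; rewrite c1 scale1r.
move=> e0 ee eev f0 ff fev.
by rewrite -(proj1 (eig1 f e f0 ff fev eev)) (proj2 (eig1 e f e0 ee eev fev)).
Qed.

Lemma tlb_s0_sq n : tlb_s0 * tlb_s0 = 1 :> TLB n.
Proof. by rewrite -expr2 -rmorphXn /= (tlb_pi_rel (tlb_ss _ _ _)) rmorph1. Qed.

Lemma tlb_U_sq n i (hi : (0 < i < n)%N) :
  tlb_U i hi ^+ 2 = - (eps * (q + q^-1)) *: tlb_U i hi :> TLB n.
Proof. by rewrite -rmorphXn -linearZ; apply/tlb_pi_rel/tlb_UU. Qed.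

Lemma tlb_UUUp n i (hi : (0 < i < n)%N) (hi1 : (0 < i.+1 < n)%N) :
  tlb_U i.+1 hi1 * tlb_U i hi * tlb_U i.+1 hi1 = tlb_U i.+1 hi1 :> TLB n.
Proof. by rewrite -!rmorphM; apply/tlb_pi_rel/tlb_UpUUp. Qed.

Lemma tlb_U1_s0_U1 n (h : (0 < 1 < n)%N) :
  tlb_U 1%N h * tlb_s0 * tlb_U 1%N h = 0 :> TLB n.
Proof.
by rewrite -!rmorphM -[0](rmorph0 (tlb_pi q eps (n:=n))); apply/tlb_pi_rel/tlb_U1sU1.
Qed.

(** The image is generated by [s_0] and the [U_i] with [i < n]. The latter are at distance at least
    2 from [U_(n+1)]; [s_0] commutes with it because [n > 0] gives index at least 2. *)
Lemma tlb_incl2_comm n (x : TLB n) (h : (0 < n.+1 < n.+2)%N) : (0 < n)%N ->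
  tlb_incl (tlb_incl x) * tlb_U n.+1 h = tlb_U n.+1 h * tlb_incl (tlb_incl x).
Proof.
move=> n_gt0; have [x' ->] := tlb_piP x.
elim/free_alg_ind: x' {x} => [|c x y IHx IHy|g x IHx].
- by rewrite !rmorph1 mul1r mulr1.
- by rewrite !linearP mulrDl mulrDr -scalerAl -scalerAr IHx IHy.
rewrite !rmorphM /= -mulrA IHx !mulrA; congr (_ * _).
case: g => [|i hi].
  by rewrite -/tlb_s0 !tlb_incl_s0 -!rmorphM; apply/tlb_pi_rel/tlb_sU.
have hi1 := widen_bound hi; have hi2 := widen_bound hi1.
rewrite -/(tlb_U i hi) (tlb_incl_U _ _ _ hi1) (tlb_incl_U _ _ _ hi2) -!rmorphM.
by apply/tlb_pi_rel/tlb_UC; case/andP: hi => _ hi; rewrite !ltnS hi.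
Qed.

Lemma tlb_b1_eigen : 2 != 0 :> k -> eta ^+ 2 = 1 ->
  b 1 * b 1 = b 1 /\ tlb_eigen 1 (b 1).
Proof.
move=> two0 eta2; have sb : tlb_s0 * b 1 = eta *: b 1.
  rewrite tlb_b1 -scalerAr mulrDr mulr1 -scalerAr tlb_s0_sq scalerA mulrC -scalerA.
  by congr (_ *: _); rewrite scalerDr scalerA -expr2 eta2 scale1r addrC.
split; last first.
  split=> // [|i hi]; last by case: i hi => [|i] // [].
  by rewrite -sb tlb_b1 -scalerAl -scalerAr mulrDl mulrDr mul1r mulr1 -scalerAl -scalerAr.
rewrite {1}tlb_b1 -scalerAl mulrDl mul1r -scalerAl sb scalerA -expr2 eta2 scale1r.
by rewrite -mulr2n -scaler_nat scalerA mulVf // scale1r.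
Qed.

Section Induction.
Hypotheses (q0 : q != 0) (d0 : forall n, d n != 0).
Hypotheses (eps2 : eps ^+ 2 = 1) (eta2 : eta ^+ 2 = 1).

(** With [y = - (eps * (q + q^-1))] and [c = eps * (d n.+1 / d n.+2)] shifted down by one, this
    identifies [y + c] as the next coefficient in the invariant. *)
Lemma qsum_rec n : d n.+2 = (q + q^-1) * d n.+1 - d n.
Proof.
have qn0 : q ^+ n != 0 by rewrite expf_neq0.
by rewrite !exprS; field; rewrite qn0 q0.
Qed.

(* [a] stands for [b_(n-1)], which is [1] when [n = 1]. *)
Lemma tlb_b_invariant n : (0 < n)%N ->
  [/\ b n * b n = b n, tlb_eigen n (b n) &
      exists a : TLB n, [/\ a * b n = b n, b n * a = b n &
        forall h : (0 < n < n.+1)%N, let u := tlb_U n h in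
        tlb_incl a * u = u * tlb_incl a /\
        u * tlb_incl (b n) * u =
          - (eps * (d n / d n.-1)) *: (tlb_incl a * u)]].
Proof.
(* [d 0] equals 2. *)
have two0 : 2 != 0 :> k by have := d0 0; rewrite expr0 invr1.
elim: n => // -[_ _|n /(_ isT) [bb bev [a [ab ba aP]]] _].
  have [bb bev] := tlb_b1_eigen two0 eta2; split=> //.
  (* Since [U_1 s_0 U_1 = 0], only half of [U_1 ^+ 2] survives, and [d 1 / d 0] is half of
     [q + q^-1]. *)
  exists 1; rewrite mul1r mulr1; split=> // h u; rewrite rmorph1 mul1r mulr1.
  split=> //; rewrite tlb_b1 linearZ linearD linearZ /= rmorph1 tlb_incl_s0.
  rewrite -scalerAr -scalerAl mulrDr mulrDl mulr1 -scalerAr -scalerAl.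
  rewrite -expr2 tlb_U_sq tlb_U1_s0_U1 scaler0 addr0 scalerA; congr (_ *: _).
  by rewrite expr0 invr1 expr1; field; rewrite two0 q0.
have h : (0 < n.+1 < n.+2)%N by rewrite ltnSn.
have [au ubu] := aP h.
set c := eps * (d n / d n.+1).
have cx : c * - (eps * (d n.+1 / d n)) = -1.
  rewrite -eps2 /c; move: (d n) (d n.+1) (d0 n) (d0 n.+1) => x y x0 y0.
  by field; rewrite x0 y0.
set B := tlb_incl (b n.+1).
have BB : B * B = B by rewrite -rmorphM bb.
have aB : tlb_incl a * B = B by rewrite -rmorphM ab.
have Ba : B * tlb_incl a = B by rewrite -rmorphM ba.
have bE : b n.+2 = B + c *: (B * tlb_U n.+1 h * B) by apply: tlb_bS.
have [sB Bs UB] : [/\ tlb_s0 * B = eta *: B, B * tlb_s0 = eta *: B &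
    forall i (hi : (0 < i < n.+1)%N) (hi' : (0 < i < n.+2)%N),
      tlb_U i hi' * B = 0 /\ B * tlb_U i hi' = 0].
  have [sb bs Ub] := bev; split=> [||i hi hi'].
  - by rewrite -tlb_incl_s0 -rmorphM sb; apply: linearZ.
  - by rewrite -tlb_incl_s0 -rmorphM bs; apply: linearZ.
  by rewrite -(tlb_incl_U _ _ hi) -!rmorphM !(Ub i hi).1 !(Ub i hi).2 rmorph0.
split.
- by rewrite bE; apply: (step_idem _ _ _ _ _ _ _ BB ubu).
- rewrite bE; split=> [||i hi].
  + by rewrite mulrDr -scalerAr !mulrA sB scalerDr -!scalerAl !scalerA [c * _]mulrC.
  + by rewrite mulrDl -scalerAl -!mulrA Bs scalerDr -!scalerAr !scalerA [c * _]mulrC.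
  (* For [i <= n] both terms vanish through [B]; the new generator, [i = n+1], needs the
     cancellation of [step_annl] and [step_annr]. *)
  have [hi1|] := boolP (0 < i < n.+1)%N.
    have [UBi BUi] := UB i hi1 hi.
    rewrite mulrDr mulrDl -scalerAr -scalerAl !mulrA UBi.
    by rewrite -(mulrA _ B) BUi mulr0 !mul0r scaler0 addr0.
  case/andP: (hi) => i0; rewrite i0 /= ltnS leq_eqVlt => /orP[/eqP i_n _|-> //].
  move: hi {i0}; rewrite i_n => hi; rewrite (bool_irrelevance hi h).
  by rewrite (step_annl _ _ _ _ _ _ _ ubu) // (step_annr _ _ _ _ _ _ _ ubu).
exists B; rewrite bE; split; [exact: step_absorbl|exact: step_absorbr|].
move=> h' v; have comm := tlb_incl2_comm n.+1 (b n.+1) h' isT; split=> //.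
rewrite linearD linearZ !rmorphM /=.
have hn : (0 < n.+1 < n.+3)%N := widen_bound h.
rewrite (tlb_incl_U _ _ _ hn).
have BB' : tlb_incl B * tlb_incl B = tlb_incl B by rewrite -rmorphM BB.
rewrite (step_cup _ _ _ _ _ _ _ BB' comm (tlb_UUUp _ _ _ _) (tlb_U_sq _ _ _)).
congr (_ *: _); rewrite qsum_rec /c; have := d0 n.+1.
by move: (d n.+1) (d n) => x y x0; field; rewrite x0 q0.
Qed.

Lemma tlb_b_neq0 n : (0 < n)%N -> b n <> 0.
Proof.
pose chi m (g : tlb_gen m) : k^o := if g is gen_s0 then eta else 0.
(* The character [chi] is followed on lifts to the free algebra; its compatibility with the
   relations is then needed only once, at the end. *)
have inclP m (y : free_alg k (tlb_gen m)) : exists y' : free_alg k (tlb_gen m.+1),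
    tlb_incl (tlb_pi q eps y) = tlb_pi q eps y' /\
    free_eval (chi m.+1) y' = free_eval (chi m) y.
  elim/free_alg_ind: y => [|c x y [x' [xE x1]] [y' [yE y1]]|g x [x' [xE x1]]].
  - by exists 1; rewrite !rmorph1.
  - by exists (c *: x' + y'); rewrite !linearP /= xE yE x1 y1.
  case: g => [|i hi].
    exists (fvar gen_s0 * x'); rewrite !rmorphM /= !free_eval_var xE x1.
    by rewrite -[tlb_pi _ _ (fvar gen_s0)]/tlb_s0 tlb_incl_s0.
  have hi' := widen_bound hi.
  exists (fvar (gen_U i hi') * x'); rewrite !rmorphM /= !free_eval_var xE x1.
  by rewrite -/(tlb_U i hi) (tlb_incl_U _ _ _ hi').
have two0 : 2 != 0 :> k by have := d0 0; rewrite expr0 invr1.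
have bP m : exists y, b m.+1 = tlb_pi q eps y /\ free_eval (chi m.+1) y = 1.
  elim: m => [|m [y [yE y1]]].
    exists (2^-1 *: (1 + eta *: fvar gen_s0)); rewrite tlb_b1.
    split; first by rewrite [RHS]linearZ rmorphD rmorph1 /= -tlb_piZ_subproof.
    rewrite linearZ rmorphD rmorph1 /= linearZ /= free_eval_var /=.
    by rewrite /GRing.scale /= -expr2 eta2 mulVf.
  have h : (0 < m.+1 < m.+2)%N by rewrite ltnSn.
  have [y' [y'E y'1]] := inclP _ y; pose c := eps * (d m / d m.+1).
  exists (y' + c *: (y' * fvar (gen_U m.+1 h) * y')); rewrite (tlb_bS _ _ _ h) yE y'E.
  split; first by rewrite linearD linearZ !rmorphM.
  by rewrite linearD linearZ !rmorphM /= free_eval_var mulr0 mul0r scaler0 addr0 y'1.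
case: n => // n _; have [y [-> y1]] := bP n.
move=> y0; suff /(@tlb_ideal_ker k q eps n.+1) E : forall x z, tlb_rel q eps x z ->
    free_eval (chi n.+1) x = free_eval (chi n.+1) z.
  have /E/eqP : tlb_pi q eps y = tlb_pi q eps 0 by rewrite y0 rmorph0.
  by rewrite y1 rmorph0 oner_eq0.
apply: (@tlb_rel_eval k q eps n.+1) => *; rewrite /chi ?mulr0 ?mul0r //.
by rewrite expr0n scaler0.
Qed.

End Induction.
End Projector.

Lemma Cq_q_neq0 (R : realType) : Cq_q R != 0.
Proof. by rewrite /Cq_q tofrac_eq0 polyX_eq0. Qed.

(** Multiplying by [q ^+ n] gives the polynomial ['X ^+ (n + n) + 1], whose value at 1 is 2, nonzero
    in characteristic 0. *)
Lemma Cq_qsum_neq0 (R : realType) n : Cq_q R ^+ n + Cq_q R ^- n != 0.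
Proof.
have qn0 : Cq_q R ^+ n != 0 by rewrite expf_neq0 // Cq_q_neq0.
rewrite -(inj_eq (mulfI qn0)) mulr0 mulrDr mulfV //.
rewrite -exprD -tofracXn -tofrac1 -tofracD tofrac_eq0.
apply/eqP => /(congr1 (horner^~ 1)); rewrite !hornerE ?hornerXn ?expr1n.
by apply/eqP; rewrite -[1 + 1]/(2%:R) Num.Theory.pnatr_eq0.
Qed.

Theorem theorem5p6 (R : realType) (eps eta : Cq R)
    (heps : eps = 1 \/ eps = -1) (heta : eta = 1 \/ eta = -1)
    (n : nat) (hn : (0 < n)%N) :
  unique
    (fun e : TLB (Cq_q R) eps n =>
       [/\ e <> 0, e * e = e,
           tlb_s0 * e = eta *: e /\ eta *: e = e * tlb_s0 &
           forall (i : nat) (hi : (0 < i < n)%N),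
             tlb_U i hi * e = 0 /\ 0 = e * tlb_U i hi])
    (tlb_b (Cq_q R) eps eta n).
Proof.
have eps2 : eps ^+ 2 = 1 by case: heps => ->; rewrite ?sqrrN expr1n.
have eta2 : eta ^+ 2 = 1 by case: heta => ->; rewrite ?sqrrN expr1n.
have q0 := Cq_q_neq0 R; have d0 := Cq_qsum_neq0 R.
have [bb bev _] := tlb_b_invariant _ _ _ _ q0 d0 eps2 eta2 n hn.
have b0 := tlb_b_neq0 _ _ eps _ d0 eta2 n hn.
split.
  have [sb bs Ub] := bev; split=> // i hi.
  by have [-> ->] := Ub i hi.
move=> e [e0 ee [se es] Ue]; have eev : tlb_eigen _ _ _ eta n e.
  by split=> // i hi; have [-> <-] := Ue i hi.
exact: (tlb_eigen_idem_unique _ _ _ _ _ _ _ b0 bb bev e0 ee eev).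
Qed.
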